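(* Let $J=\{1,\dots,n\}$, let $x_j\in\mathbb{R}^m$, $y_j\in\mathbb{R}^s$ ($j\in J$) be vectors with strictly positive components, and let $DMU_o=(x_o,y_o)$, $o\in J$, be $FDH_V$-efficient. Consider the following two systems in the variables $\lambda_1,\dots,\lambda_n,\delta$: $$(C)\quad \sum_{j\in J}\lambda_jx_j\le\delta x_o,\quad \sum_{j\in J}\lambda_jy_j\ge\delta y_o,\quad \sum_{j\in J}\lambda_j=1,\quad \lambda_j\in\{0,1\}\ (j\in J),\quad \delta\in(0,1);$$ $$(D)\quad \sum_{j\in J}\lambda_jx_j<\delta x_o,\quad \sum_{j\in J}\lambda_jy_j>\delta y_o,\quad \sum_{j\in J}\lambda_j=1,\quad \lambda_j\in\{0,1\}\ (j\in J),\quad \delta\in(0,1).$$ Then: (i) Left-IRS prevails at $DMU_o$ if and only if system (C) has no solution. (ii) Left-DRS prevails at $DMU_o$ if and only if system (D) has some solution. (iii) Left-CRS prevails at $DMU_o$ if and only if system (C) has some solution and system (D) has no solution.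
   Context: There are $n$ decision making units $DMU_j=(x_j,y_j)$, $j\in J$, with strictly positive input vectors $x_j\in\mathbb{R}^m$ and output vectors $y_j\in\mathbb{R}^s$. Vector inequalities (strict or not) are componentwise. The technology is $$T^{FDH_V}=\Big\{(x,y)\in\mathbb{R}^m\times\mathbb{R}^s:\ \exists\,\lambda\in\{0,1\}^n,\ \sum_{j}\lambda_j=1,\ \sum_j\lambda_jx_j\le x,\ \sum_j\lambda_jy_j\ge y\ge0\Big\}.$$ $DMU_o$ is $FDH_V$-efficient if there is no $(x,y)\in T^{FDH_V}$ with $x\le x_o$, $y\ge y_o$, $(x,y)\neq(x_o,y_o)$. $\operatorname{int}A$ and $A^c$ denote the interior and the complement of a set $A$ (in $\mathbb{R}^{m+s}$), and $z_\delta:=(\delta x_o,\delta y_o)$. One-sided returns to scale on the left, for an $FDH_V$-efficient $DMU_o$: Left-IRS prevails if $z_\delta\in(T^{FDH_V})^c$ for each $0<\delta<1$; Left-DRS prevails if $z_\delta\in\operatorname{int}T^{FDH_V}$ for some $0<\delta<1$; Left-CRS prevails if neither Left-IRS nor Left-DRS prevails. *)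

(* Defs.v *)
From HB Require Import structures.
From mathcomp Require Import all_boot all_order all_algebra.
From mathcomp Require Import all_classical all_reals all_analysis.
Import Order.TTheory GRing.Theory Num.Theory.
Import numFieldNormedType.Exports.

Set Implicit Arguments.
Unset Strict Implicit.
Unset Printing Implicit Defensive.

Local Open Scope classical_set_scope.
Local Open Scope ring_scope.

Definition vle (R : realType) (k : nat) (u v : 'rV[R]_k) : Prop :=
  forall i : 'I_k, u ord0 i <= v ord0 i.

(* Strict in every component; this is not "vle and different". *)
Definition vlt (R : realType) (k : nat) (u v : 'rV[R]_k) : Prop :=
  forall i : 'I_k, u ord0 i < v ord0 i.

Definition fdh_weights (R : realType) (n : nat) (lam : 'I_n -> R) : Prop :=
  (forall j, lam j = 0 \/ lam j = 1) /\ \sum_(j < n) lam j = 1.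

(* R^(m+s) is rendered as the product of the input space R^m and the output
   space R^s, with its product topology. *)
Definition fdh_v (R : realType) (m s n : nat)
    (X : 'I_n -> 'rV[R]_m) (Y : 'I_n -> 'rV[R]_s) :
    set ('rV[R]_m * 'rV[R]_s) :=
  [set z | exists lam : 'I_n -> R,
    [/\ fdh_weights lam,
        vle (\sum_(j < n) lam j *: X j) z.1,
        vle z.2 (\sum_(j < n) lam j *: Y j) &
        vle 0 z.2]].

Definition fdh_v_efficient (R : realType) (m s n : nat)
    (X : 'I_n -> 'rV[R]_m) (Y : 'I_n -> 'rV[R]_s) (o : 'I_n) : Prop :=
  ~ exists z : 'rV[R]_m * 'rV[R]_s,
    [/\ fdh_v X Y z, vle z.1 (X o), vle (Y o) z.2 & z <> (X o, Y o)].

Definition ray_point (R : realType) (m s n : nat)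
    (X : 'I_n -> 'rV[R]_m) (Y : 'I_n -> 'rV[R]_s) (o : 'I_n) (delta : R) :
    'rV[R]_m * 'rV[R]_s :=
  (delta *: X o, delta *: Y o).

(* The three left returns-to-scale classes are meaningful for efficient units
   only; efficiency is assumed where they are used. *)
Definition left_IRS (R : realType) (m s n : nat)
    (X : 'I_n -> 'rV[R]_m) (Y : 'I_n -> 'rV[R]_s) (o : 'I_n) : Prop :=
  forall delta : R, 0 < delta < 1 ->
    (~` fdh_v X Y) (ray_point X Y o delta).

Definition left_DRS (R : realType) (m s n : nat)
    (X : 'I_n -> 'rV[R]_m) (Y : 'I_n -> 'rV[R]_s) (o : 'I_n) : Prop :=
  exists delta : R, 0 < delta < 1 /\
    interior (fdh_v X Y) (ray_point X Y o delta).

Definition left_CRS (R : realType) (m s n : nat)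
    (X : 'I_n -> 'rV[R]_m) (Y : 'I_n -> 'rV[R]_s) (o : 'I_n) : Prop :=
  ~ left_IRS X Y o /\ ~ left_DRS X Y o.

Definition system_C (R : realType) (m s n : nat)
    (X : 'I_n -> 'rV[R]_m) (Y : 'I_n -> 'rV[R]_s) (o : 'I_n)
    (lam : 'I_n -> R) (delta : R) : Prop :=
  [/\ vle (\sum_(j < n) lam j *: X j) (delta *: X o),
      vle (delta *: Y o) (\sum_(j < n) lam j *: Y j),
      \sum_(j < n) lam j = 1,
      (forall j, lam j = 0 \/ lam j = 1) &
      0 < delta < 1].

Definition system_D (R : realType) (m s n : nat)
    (X : 'I_n -> 'rV[R]_m) (Y : 'I_n -> 'rV[R]_s) (o : 'I_n)
    (lam : 'I_n -> R) (delta : R) : Prop :=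
  [/\ vlt (\sum_(j < n) lam j *: X j) (delta *: X o),
      vlt (delta *: Y o) (\sum_(j < n) lam j *: Y j),
      \sum_(j < n) lam j = 1,
      (forall j, lam j = 0 \/ lam j = 1) &
      0 < delta < 1].

(* Main.v *)
Require Import Defs.
From mathcomp Require Import all_boot all_order all_algebra.
From mathcomp Require Import all_classical all_reals all_analysis.
Import Order.TTheory GRing.Theory Num.Theory.
Import numFieldNormedType.Exports.

Set Implicit Arguments.
Unset Strict Implicit.
Unset Printing Implicit Defensive.

Local Open Scope classical_set_scope.
Local Open Scope ring_scope.

(** System (C) at a given scale [delta] is the membership of the ray point in
    the technology: the only clause of the latter that (C) omits is the
    nonnegativity of the outputs, which is automatic since [delta *: Y o] is
    positive.  This gives (i).

    For (ii), system (D) at scale [delta] holds for some weights exactly when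
    the ray point is interior.  If the strict inequalities hold, then they
    survive small perturbations of the point with the same weights, there being
    finitely many coordinates ([near_vlt]); positivity of the outputs survives
    as well.  Conversely, an interior point can be moved slightly in the
    direction that lowers all inputs and raises all outputs without leaving the
    technology ([interior_improvable]); the weights that witness membership of
    the improved point satisfy the strict inequalities at the original one,
    because all components of [X o] and [Y o] are positive.

    (iii) is the conjunction of the negations of (i) and (ii). *)

Lemma vle_lt_trans (R : realType) (k : nat) (v u w : 'rV[R]_k) :
  vle u v -> vlt v w -> vlt u w.
Proof. by move=> uv vw i; exact: le_lt_trans (uv i) (vw i). Qed.

Lemma vlt_le_trans (R : realType) (k : nat) (v u w : 'rV[R]_k) :
  vlt u v -> vle v w -> vlt u w.
Proof. by move=> uv vw i; exact: lt_le_trans (uv i) (vw i). Qed.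

Lemma vltW (R : realType) (k : nat) (u v : 'rV[R]_k) : vlt u v -> vle u v.
Proof. by move=> uv i; exact: ltW. Qed.

Lemma vlt_scale (R : realType) (k : nat) (a b : R) (u : 'rV[R]_k) :
  vlt 0 u -> a < b -> vlt (a *: u) (b *: u).
Proof.
move=> u0 ab i; rewrite !mxE ltr_pM2r //.
by have := u0 i; rewrite mxE.
Qed.

Lemma vlt_scale_gt0 (R : realType) (k : nat) (a : R) (u : 'rV[R]_k) :
  vlt 0 u -> 0 < a -> vlt 0 (a *: u).
Proof. by move=> u0 a0; rewrite -(scale0r u); exact: vlt_scale. Qed.

(** Each coordinate inequality persists near the limit, and a finite
    intersection of neighbourhoods is a neighbourhood. *)
Lemma near_vlt (R : realType) (k : nat) (T : Type) (F : set_system T)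
    (f g : T -> 'rV[R]_k) (u v : 'rV[R]_k) :
  Filter F -> f @ F --> u -> g @ F --> v -> vlt u v ->
  \forall t \near F, vlt (f t) (g t).
Proof.
move=> FF fu gv uv; apply: filter_forall => i.
have coord (h : T -> 'rV[R]_k) (w : 'rV[R]_k) :
    h @ F --> w -> (fun t => h t ord0 i) @ F --> w ord0 i.
  by move=> hw; exact: (cvg_comp _ _ hw (@coord_continuous R 1 k ord0 i w)).
have fi := coord _ _ fu; have gi := coord _ _ gv.
have gap : 0 < v ord0 i - u ord0 i by rewrite subr_gt0.
apply: filterS (cvgr_gt _ (cvgB gi fi) _ gap) => t /=.
by rewrite subr_gt0.
Qed.

(** The coefficients [delta - e] and [delta + e] tend to [delta] as [e] tends
    to [0] from the right, so the improved points converge to the original one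
    and eventually lie in any of its neighbourhoods. *)
Lemma interior_improvable (R : realType) (p q : nat)
    (A : set ('rV[R]_p * 'rV[R]_q)) (x : 'rV[R]_p) (y : 'rV[R]_q) (delta : R) :
  interior A (delta *: x, delta *: y) ->
  exists e : R, 0 < e /\ A ((delta - e) *: x, (delta + e) *: y).
Proof.
move=> intA.
have e0 : (fun e : R => e) @ 0^'+ --> (0 : R).
  by apply: cvg_at_right_filter; exact: cvg_id.
have eA : \forall e \near 0^'+, A ((delta - e) *: x, (delta + e) *: y).
  have cx : (fun e : R => (delta - e) *: x) @ 0^'+ --> delta *: x.
    apply: cvgZr_tmp; rewrite -[X in _ --> X]subr0.
    by apply: cvgB => //; exact: cvg_cst.
  have cy : (fun e : R => (delta + e) *: y) @ 0^'+ --> delta *: y.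
    apply: cvgZr_tmp; rewrite -[X in _ --> X]addr0.
    by apply: cvgD => //; exact: cvg_cst.
  exact: (cvg_pair cx cy intA).
have e_gt0 : \forall e \near (0 : R)^'+, 0 < e by exact: nbhs_right_gt.
by have [e [? ?]] := filter_ex (filterI e_gt0 eA); exists e.
Qed.

Section RayPoint.
Variables (R : realType) (m s n : nat).
Variables (X : 'I_n -> 'rV[R]_m) (Y : 'I_n -> 'rV[R]_s) (o : 'I_n).
Hypotheses (X_gt0 : forall j, vlt 0 (X j)) (Y_gt0 : forall j, vlt 0 (Y j)).

Lemma ray_point_fdhP (delta : R) : 0 < delta < 1 ->
  fdh_v X Y (ray_point X Y o delta) <-> exists lam, system_C X Y o lam delta.
Proof.
move=> d01; split=> [[lam [[lam01 lam1] hX hY _]]|].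
  by exists lam; split.
case=> lam [hX hY lam1 lam01 /andP[d0 _]]; exists lam; split=> //.
exact/vltW/vlt_scale_gt0.
Qed.

Lemma ray_point_interiorP (delta : R) : 0 < delta < 1 ->
  interior (fdh_v X Y) (ray_point X Y o delta) <->
  exists lam, system_D X Y o lam delta.
Proof.
move=> d01; split.
  move=> /interior_improvable[e [e0 [lam [[lam01 lam1] hX hY _]]]].
  exists lam; split=> //.
    by apply: vle_lt_trans hX _; apply: vlt_scale => //=; rewrite gtrBl.
  by apply: vlt_le_trans hY; apply: vlt_scale => //=; rewrite ltrDl.
case=> lam [hX hY lam1 lam01 /andP[d0 _]].
have z1 : (@fst 'rV[R]_m 'rV[R]_s) @ nbhs (ray_point X Y o delta)
    --> delta *: X o by exact: cvg_fst.
have z2 : (@snd 'rV[R]_m 'rV[R]_s) @ nbhs (ray_point X Y o delta)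
    --> delta *: Y o by exact: cvg_snd.
rewrite /interior; near=> z.
have zX : vlt (\sum_(j < n) lam j *: X j) z.1.
  by near: z; apply: near_vlt (cvg_cst _) z1 hX.
have zY : vlt z.2 (\sum_(j < n) lam j *: Y j).
  by near: z; apply: near_vlt z2 (cvg_cst _) hY.
have z0 : vlt 0 z.2.
  by near: z; apply: near_vlt (cvg_cst _) z2 (vlt_scale_gt0 (Y_gt0 o) d0).
by exists lam; split=> //; exact: vltW.
Unshelve. all: by end_near. Qed.

Lemma left_IRSP : left_IRS X Y o <->
  ~ exists (lam : 'I_n -> R) (delta : R), system_C X Y o lam delta.
Proof.
split=> [irs [lam [delta C]]|noC delta d01 /(ray_point_fdhP d01)[lam C]].
  have d01 : 0 < delta < 1 by case: C.
  by apply: (irs delta d01); apply/(ray_point_fdhP d01); exists lam.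
by apply: noC; exists lam, delta.
Qed.

Lemma left_DRSP : left_DRS X Y o <->
  exists (lam : 'I_n -> R) (delta : R), system_D X Y o lam delta.
Proof.
split=> [[delta [d01 /(ray_point_interiorP d01)[lam D]]]|[lam [delta D]]].
  by exists lam, delta.
have d01 : 0 < delta < 1 by case: D.
by exists delta; split=> //; apply/(ray_point_interiorP d01); exists lam.
Qed.

End RayPoint.

Theorem theorem3 (R : realType) (m s n : nat)
    (X : 'I_n -> 'rV[R]_m) (Y : 'I_n -> 'rV[R]_s) (o : 'I_n)
    (X_gt0 : forall j : 'I_n, vlt 0 (X j))
    (Y_gt0 : forall j : 'I_n, vlt 0 (Y j))
    (o_efficient : fdh_v_efficient X Y o) :
  [/\ left_IRS X Y o <->
        ~ (exists (lam : 'I_n -> R) (delta : R), system_C X Y o lam delta),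
      left_DRS X Y o <->
        (exists (lam : 'I_n -> R) (delta : R), system_D X Y o lam delta) &
      left_CRS X Y o <->
        (exists (lam : 'I_n -> R) (delta : R), system_C X Y o lam delta) /\
        ~ (exists (lam : 'I_n -> R) (delta : R), system_D X Y o lam delta)].
Proof.
have irs := left_IRSP X o Y_gt0; have drs := left_DRSP o X_gt0 Y_gt0.
split=> //; rewrite /left_CRS irs drs.
by split=> -[c d]; split=> //; exact: contrapT.
Qed.
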